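(* Let $\mathcal{C}\subseteq\mathbb{R}^n$ be a compact convex set, let $f\colon\mathcal{C}\to\mathbb{R}$ be convex and differentiable in an open set containing $\mathcal{C}$, let $\eta_t=\frac{\ell}{t+\ell}$ for some integer $\ell\ge 1$ and all $t\in\mathbb{N}$, and suppose that $(\mathcal{C},f)$ satisfies the strong $(M,0)$-growth property and the strong $(M,r)$-growth property for some $M>0$ and $r\in[0,1)$. Let $\epsilon\in(0,\ell)$ and $k=\min\{\ell-\epsilon,\frac{1}{1-r}\}$. Let $(x_t)_{t\in\mathbb{N}}$ be the iterates of the Frank-Wolfe algorithm with step-sizes $\eta_t$. Then: (i) For all integers $t\ge 1$, $$\mathrm{primaldual}_t\le\exp(\epsilon\ell)\max\left\{\eta_{t-1}^{\ell-\epsilon}\frac{M}{2},\ \eta_{t-1}^{k}\left(\frac{\ell M}{2\epsilon}\right)^{\frac{1}{1-r}}\right\}=\mathcal{O}\left(t^{-\ell+\epsilon}+t^{-\frac{1}{1-r}}\right).$$ (ii) Let $c=\exp\left(\frac{1}{\min\{\ell-\epsilon,\frac{1}{1-r}\}}\right)$. Then, for all $t\in\mathbb{N}$ with $t\ge\lceil c\cdot(1+\ell)-\ell\rceil$, $$\min_{i\in\{0,1,\ldots,t\}}\mathrm{gap}_i\le\exp(3+\epsilon\ell)\,\eta_{t-1}^{k}\max\left\{\frac{M}{2},\ \left(\frac{\ell M}{2\epsilon}\right)^{\frac{1}{1-r}}\right\}=\mathcal{O}\left(t^{-\ell+\epsilon}+t^{-\frac{1}{1-r}}\right).$$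
   Context: $\mathbb{N}=\{0,1,2,\ldots\}$. Frank-Wolfe algorithm for $\min_{x\in\mathcal{C}}f(x)$ with step-sizes $\eta_t\in[0,1]$: given any $x_0\in\mathcal{C}$, for $t=0,1,2,\ldots$ choose any $v_t\in\operatorname{argmin}_{v\in\mathcal{C}}\langle\nabla f(x_t),v-x_t\rangle$ and set $x_{t+1}=x_t+\eta_t(v_t-x_t)$. For $x,y\in\mathcal{C}$: $D_f(y,x)=f(y)-f(x)-\langle\nabla f(x),y-x\rangle$ and $\mathrm{gap}(x)=\max_{v\in\mathcal{C}}\langle\nabla f(x),x-v\rangle$. For the iterates, $\mathrm{gap}_t=\mathrm{gap}(x_t)$ and $$\mathrm{primaldual}_t=\min_{k=0,\ldots,t}\{f(x_t)+f^*(\nabla f(x_k))+\sigma_{\mathcal{C}}(-\nabla f(x_k))\}=\min_{k=0,\ldots,t}\{f(x_t)-f(x_k)+\mathrm{gap}(x_k)\},$$ where $f^*(u)=\sup_{x\in\mathcal{C}}\{\langle u,x\rangle-f(x)\}$ and $\sigma_{\mathcal{C}}(u)=\max_{x\in\mathcal{C}}\langle u,x\rangle$. For $M>0$ and $r\in[0,1]$, $(\mathcal{C},f)$ satisfies the strong $(M,r)$-growth property if for all $x\in\mathcal{C}$ and all $v\in\operatorname{argmin}_{y\in\mathcal{C}}\langle\nabla f(x),y-x\rangle$, $$D_f(x+\eta(v-x),x)\le\frac{M\eta^2}{2}\,\mathrm{gap}(x)^r\quad\text{for all }\eta\in[0,1],$$ with the convention that for $r=0$ the right-hand side is $\frac{M\eta^2}{2}$.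 *)

(* Defs.v *)
From HB Require Import structures.
From mathcomp Require Import all_boot all_order all_algebra.
From mathcomp Require Import all_classical all_reals all_analysis.

Set Implicit Arguments.
Unset Strict Implicit.
Unset Printing Implicit Defensive.

Import Order.TTheory GRing.Theory Num.Theory.
Import numFieldNormedType.Exports.

Local Open Scope classical_set_scope.
Local Open Scope ring_scope.

Definition dotp (R : realType) (n : nat) (u v : 'rV[R]_n) : R :=
  \sum_(i < n) u 0 i * v 0 i.

Definition grad (R : realType) (n : nat) (f : 'rV[R]_n -> R) (x : 'rV[R]_n) :
    'rV[R]_n :=
  \row_(i < n) 'D_(delta_mx 0 i) f x.

Definition bregman (R : realType) (n : nat) (f : 'rV[R]_n -> R)
    (y x : 'rV[R]_n) : R :=
  f y - f x - dotp (grad f x) (y - x).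

(* The suprema below are real-valued ([sup] is 0 on an empty or unbounded set).
   They are used for a nonempty compact C and for f differentiable at every
   point of C, where they are attained: writing "sup" for "max" is harmless,
   and the conjugate is finite. *)

Definition support_fun (R : realType) (n : nat) (C : set 'rV[R]_n)
    (u : 'rV[R]_n) : R :=
  sup [set dotp u x | x in C].

(* The conjugate of f restricted to C. *)
Definition conjugate (R : realType) (n : nat) (C : set 'rV[R]_n)
    (f : 'rV[R]_n -> R) (u : 'rV[R]_n) : R :=
  sup [set dotp u x - f x | x in C].

Definition gap (R : realType) (n : nat) (C : set 'rV[R]_n)
    (f : 'rV[R]_n -> R) (x : 'rV[R]_n) : R :=
  sup [set dotp (grad f x) (x - v) | v in C].

Definition lin_argmin (R : realType) (n : nat) (C : set 'rV[R]_n)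
    (f : 'rV[R]_n -> R) (x : 'rV[R]_n) : set 'rV[R]_n :=
  [set v | C v /\
    forall y, C y -> dotp (grad f x) (v - x) <= dotp (grad f x) (y - x)].

(* The convention for r = 0 holds because a `^ 0 = 1 for every a, 0 included
   (lemma powRr0). *)
Definition strong_growth (R : realType) (n : nat) (C : set 'rV[R]_n)
    (f : 'rV[R]_n -> R) (M r : R) : Prop :=
  forall x v, C x -> lin_argmin C f x v ->
  forall eta : R, 0 <= eta <= 1 ->
    bregman f (x + eta *: (v - x)) x <= M * eta ^+ 2 / 2 * gap C f x `^ r.

Definition frank_wolfe (R : realType) (n : nat) (C : set 'rV[R]_n)
    (f : 'rV[R]_n -> R) (eta : nat -> R) (x v : nat -> 'rV[R]_n) : Prop :=
  C (x 0%N) /\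
  forall t, lin_argmin C f (x t) (v t) /\
            x t.+1 = x t + eta t *: (v t - x t).

(* Num.min has no neutral element; the seed F 0 is one of the t + 1 terms. *)
Definition running_min (R : realType) (F : nat -> R) (t : nat) : R :=
  \big[Num.min/F 0%N]_(i < t.+1) F i.

Definition primaldual (R : realType) (n : nat) (C : set 'rV[R]_n)
    (f : 'rV[R]_n -> R) (x : nat -> 'rV[R]_n) (t : nat) : R :=
  running_min (fun k => f (x t) + conjugate C f (grad f (x k))
                        + support_fun C (- grad f (x k))) t.

Definition stepsize (R : realType) (l t : nat) : R := l%:R / (t + l)%:R.

(* Main.v *)
Require Import Defs.
From HB Require Import structures.
From mathcomp Require Import all_boot all_order all_algebra.
From mathcomp Require Import all_classical all_reals all_analysis.
From mathcomp Require Import ring lra zify.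

Set Implicit Arguments.
Unset Strict Implicit.
Unset Printing Implicit Defensive.

Import Order.TTheory GRing.Theory Num.Theory.
Import numFieldNormedType.Exports.

Local Open Scope classical_set_scope.
Local Open Scope ring_scope.

(* With p = 1/(1-r), a = l - eps, k = min(a, p) and G_t = eta_t^p K, comparing
   gap_t with G_t turns the growth term M eta_t^2 gap_t^r / 2 into at most
   (eps/l) eta_t max(gap_t, G_t), whence
     primaldual_(t+1) <= (1 - a/(t+l)) max(primaldual_t, G_t).
   The products of the factors 1 - a/(s+l) = (s/(s+l)) (1 + eps/s) are bounded
   by Bernoulli's inequality and 1 + y <= e^y, while a single G_j decays like
   ((j+l)/(t+l))^k; this gives (i).
   For (ii), if every gap up to t exceeded the bound B, then gap_s > G_s on the
   window (t+l)/c < s+l <= t+l, where the primal-dual gap would lose at least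
   a B/(s+l) per step, that is at least B/2 in total (the window has logarithmic
   length about 1/k); but by (i) it is at most B/e at the start of the window
   and it stays nonnegative. *)

(** * Attained suprema and running minima *)

(** The gap, the conjugate and the support function are all evaluated by exhibiting a maximizer,
    which rules out the default value of [sup]. *)
Lemma sup_image_max (R : realType) (T : Type) (A : set T) (F : T -> R) (a : T) :
  A a -> (forall b, A b -> F b <= F a) -> sup [set F b | b in A] = F a.
Proof.
move=> Aa Fa; have ubF : ubound [set F b | b in A] (F a).
  by move=> _ [b Ab <-]; exact: Fa.
apply/eqP; rewrite eq_le; apply/andP; split.
  by apply: ge_sup => //; exists (F a), a.
by apply: ub_le_sup; [exists (F a) | exists a].
Qed.

Lemma le_running_min (R : realType) (F : nat -> R) (t : nat) (B : R) :
  (forall i, (i <= t)%N -> B <= F i) -> B <= running_min F t.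
Proof.
by move=> FB; apply/bigmin_geP; split=> [|i _]; apply: FB; rewrite // -ltnS.
Qed.

Lemma running_min_le (R : realType) (F : nat -> R) (t i : nat) :
  (i <= t)%N -> running_min F t <= F i.
Proof.
move=> it; rewrite -ltnS in it.
exact: (bigmin_le (F 0%N) (Ordinal it) (fun j : 'I_t.+1 => F j)).
Qed.

Lemma eq_running_min (R : realType) (F G : nat -> R) (t : nat) :
  (forall i, (i <= t)%N -> F i = G i) -> running_min F t = running_min G t.
Proof.
move=> FG; rewrite /running_min FG//; apply: eq_bigr => i _.
by apply: FG; rewrite -ltnS.
Qed.

(** * Inner product, gradient and the tangent inequality for convex functions *)

Section dot_product.
Context (R : realType) (n : nat).
Implicit Types u v w : 'rV[R]_n.

Lemma dotpDr u v w : dotp u (v + w) = dotp u v + dotp u w.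
Proof.
by rewrite /dotp -big_split; apply: eq_bigr => i _; rewrite !mxE mulrDr.
Qed.

Lemma dotpZr (a : R) u v : dotp u (a *: v) = a * dotp u v.
Proof.
by rewrite /dotp mulr_sumr; apply: eq_bigr => i _; rewrite !mxE mulrCA.
Qed.

Lemma dotpNr u v : dotp u (- v) = - dotp u v.
Proof. by rewrite -scaleN1r dotpZr mulN1r. Qed.

Lemma dotpBr u v w : dotp u (v - w) = dotp u v - dotp u w.
Proof. by rewrite dotpDr dotpNr. Qed.

Lemma dotpNl u v : dotp (- u) v = - dotp u v.
Proof. by rewrite /dotp -sumrN; apply: eq_bigr => i _; rewrite !mxE mulNr. Qed.

Lemma derive_dotp_grad (f : 'rV[R]_n -> R) x v :
  differentiable f x -> 'D_v f x = dotp (grad f x) v.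
Proof.
move=> df; rewrite deriveE// [in LHS](row_sum_delta v) linear_sum.
apply: eq_bigr => i _; rewrite linearZ /= !mxE deriveE// mulrC.
by [].
Qed.

(** Convexity bounds the difference quotient along [y - x] by [f y - f x] for every step h in (0,
    1]; let h tend to 0. *)
Lemma convex_tangent_le (C : set 'rV[R]_n) (f : 'rV[R]_n -> R) x y :
  convex_function C f -> differentiable f x -> C x -> C y ->
  dotp (grad f x) (y - x) <= f y - f x.
Proof.
move=> cf df Cx Cy; rewrite -derive_dotp_grad//.
have dv : derivable f x (y - x) by exact: diff_derivable.
(* The quotient is controlled only for h > 0, so the two-sided limit is replaced by the limit from
   the right. *)
rewrite /derive cvg_at_rightE//; apply: limr_le.
  rewrite -(cvg_at_rightE (fun h : R =>
    h^-1 *: ((f \o shift x) (h *: (y - x)) - f x)))//.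
  apply: cvg_trans dv; apply: cvg_app.
  by move=> A [e e0 Ae]; exists e => // z ze z0; apply: Ae => //;
    exact/lt0r_neq0.
near=> h.
have h0 : 0 < h by near: h; exists 1 => /=.
have h1 : h <= 1.
  near: h; exists 1 => //= z /=; rewrite sub0r normrN => z1 z0.
  by rewrite (le_trans (ler_norm _))// ltW.
rewrite [leLHS](_ : _ = (f (h *: (y - x) + x) - f x) / h); last by rewrite mulrC.
rewrite ler_pdivrMr//.
have fyx : f (h *: y + (1 - h) *: x) <= h * f y + (1 - h) * f x.
  by apply: (cf (Itv01 (ltW h0) h1) y x); rewrite inE.
have -> : h *: (y - x) + x = h *: y + (1 - h) *: x.
  by rewrite scalerBr scalerBl scale1r addrAC addrA.
by move: fyx; lra.
Unshelve. all: by end_near. Qed.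

End dot_product.

(** * Frank-Wolfe steps, duality, and one-step descent of the primal-dual gap *)

Section frank_wolfe_theory.
Context (R : realType) (n : nat) (C : set 'rV[R]_n) (f : 'rV[R]_n -> R).
Implicit Types u w y : 'rV[R]_n.

Lemma gap_lin_argmin y w :
  lin_argmin C f y w -> gap C f y = dotp (grad f y) (y - w).
Proof.
move=> [Cw wmin]; apply: sup_image_max => // z /wmin.
by rewrite !dotpBr; lra.
Qed.

Lemma gap_ge y w z :
  lin_argmin C f y w -> C z -> dotp (grad f y) (y - z) <= gap C f y.
Proof.
move=> yw Cz; rewrite (gap_lin_argmin yw); case: yw => _ /(_ z Cz).
by rewrite !dotpBr; lra.
Qed.

Lemma support_fun_lin_argmin y w :
  lin_argmin C f y w -> support_fun C (- grad f y) = - dotp (grad f y) w.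
Proof.
move=> [Cw wmin]; rewrite -dotpNl; apply: sup_image_max => // z /wmin.
by rewrite !dotpNl !dotpBr; lra.
Qed.

(** Fenchel equality: by the tangent inequality, [y] itself attains the supremum defining the
    conjugate at its own gradient. *)
Lemma conjugate_grad y : convex_function C f -> differentiable f y -> C y ->
  conjugate C f (grad f y) = dotp (grad f y) y - f y.
Proof.
move=> cf df Cy.
apply: (@sup_image_max _ _ _ (fun z => dotp (grad f y) z - f z)) => // z Cz.
by have := convex_tangent_le cf df Cy Cz; rewrite dotpBr; lra.
Qed.

(** The slope of [f] at [y] along [w - y] is minus the gap, so unfolding the Bregman divergence
    turns growth into descent. *)
Lemma strong_growth_descent (M r : R) y w (h : R) :
  strong_growth C f M r -> C y -> lin_argmin C f y w -> 0 <= h <= 1 ->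
  f (y + h *: (w - y)) <=
    f y - h * gap C f y + M * h ^+ 2 / 2 * gap C f y `^ r.
Proof.
move=> gr Cy yw h01; have := gr _ _ Cy yw _ h01.
rewrite /bregman (addrC y) addrK dotpZr -[w - y]opprB dotpNr.
by rewrite -(gap_lin_argmin yw); lra.
Qed.

Lemma stepsize_itv (l t : nat) : 0 <= stepsize R l t <= 1.
Proof.
(* If t + l = 0, division by zero gives the value 0, which still lies in [0, 1]. *)
rewrite /stepsize divr_ge0//=; have [->|l0] := eqVneq (t + l)%N 0%N.
  by rewrite invr0 mulr0.
by rewrite ler_pdivrMr ?ltr0n ?lt0n// mul1r ler_nat leq_addl.
Qed.

Context (l : nat) (x v : nat -> 'rV[R]_n).
Context (x_FW : frank_wolfe C f (stepsize R l) x v).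

Lemma frank_wolfe_argmin t : lin_argmin C f (x t) (v t).
Proof. by have [] := x_FW.2 t. Qed.

Lemma frank_wolfe_in (C_convex : convex_set C) t : C (x t).
Proof.
elim: t => [|t Cxt]; first exact: x_FW.1.
have /andP[h0 h1] := stepsize_itv l t.
have [[Cv _] ->] := x_FW.2 t.
have := C_convex (v t) (x t) (Itv01 h0 h1); rewrite !inE => /(_ Cv Cxt).
rewrite [X in C X -> _](_ : _ =
  stepsize R l t *: v t + (1 - stepsize R l t) *: x t)//.
by rewrite scalerBr scalerBl scale1r addrA addrAC [_ + x t]addrC !addrA.
Qed.

Context (C_convex : convex_set C).
Context (f_convex : convex_function C f).
Context (f_diff : forall y, C y -> differentiable f y).

(** By Fenchel equality, conjugate plus support function at the gradient of [x k] equals the gap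
    there minus [f (x k)]. *)
Lemma primaldualE t : primaldual C f x t =
  running_min (fun k => f (x t) - f (x k) + gap C f (x k)) t.
Proof.
apply: eq_running_min => k _.
have Cxk := frank_wolfe_in C_convex k.
have xv := frank_wolfe_argmin k.
rewrite (conjugate_grad f_convex (f_diff Cxk) Cxk) (support_fun_lin_argmin xv).
by rewrite (gap_lin_argmin xv) dotpBr; lra.
Qed.

(** Weak duality: the gap at [x k] dominates the linear decrease towards [x t], which dominates
    [f (x k) - f (x t)] by convexity. *)
Lemma primaldual_ge0 t : 0 <= primaldual C f x t.
Proof.
rewrite primaldualE; apply: le_running_min => k _.
have Cxk := frank_wolfe_in C_convex k; have Cxt := frank_wolfe_in C_convex t.
have := convex_tangent_le f_convex (f_diff Cxk) Cxk Cxt.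
have := gap_ge (frank_wolfe_argmin k) Cxt.
by rewrite !dotpBr; lra.
Qed.

Lemma primaldual_le_gap t : primaldual C f x t <= gap C f (x t).
Proof.
rewrite primaldualE; apply: le_trans (running_min_le _ (leqnn t)) _ => /=.
by rewrite subrr add0r.
Qed.

Lemma primaldual_descent (M r : R) t : strong_growth C f M r ->
  primaldual C f x t.+1 <= primaldual C f x t - stepsize R l t * gap C f (x t)
    + M * stepsize R l t ^+ 2 / 2 * gap C f (x t) `^ r.
Proof.
move=> gr; have Cxt := frank_wolfe_in C_convex t.
have := strong_growth_descent gr Cxt (frank_wolfe_argmin t) (stepsize_itv l t).
rewrite -(x_FW.2 t).2 => xS.
(* From t to t + 1, each term with index k <= t shifts by the same amount [f (x t.+1) - f (x t)],
   and the extra term can only lower the minimum. *)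
suff : primaldual C f x t.+1 - f (x t.+1) + f (x t) <= primaldual C f x t by lra.
rewrite [leRHS]primaldualE; apply: le_running_min => k kt.
rewrite primaldualE; have := running_min_le
  (fun k => f (x t.+1) - f (x k) + gap C f (x k)) (leqW kt).
by rewrite /=; lra.
Qed.

(** As eta_0 = 1, the first step subtracts all of gap_0, which is at least primaldual_0; only the
    growth term remains. *)
Lemma primaldual1_le (M : R) : (0 < l)%N -> strong_growth C f M 0 ->
  primaldual C f x 1 <= M / 2.
Proof.
move=> l0 gr; apply: le_trans (primaldual_descent 0 gr) _.
have -> : stepsize R l 0 = 1 by rewrite /stepsize divff// pnatr_eq0 -lt0n.
by have := primaldual_le_gap 0; rewrite powRr0 expr1n; lra.
Qed.

End frank_wolfe_theory.

(** * Elementary inequalities for powers, logarithms and harmonic sums *)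

Section real_inequalities.
Context (R : realType).
Implicit Types a b g k u y : R.

Lemma bernoulli_sub y (m : nat) : 0 <= y <= 1 -> 1 - m%:R * y <= (1 - y) ^+ m.
Proof.
move=> /andP[y0 y1]; elim: m => [|m IHm]; first by rewrite mul0r subr0 expr0.
have -> : (1 - y) ^+ m.+1 = (1 - y) * (1 - y) ^+ m by rewrite exprS.
apply: le_trans (ler_wpM2l _ IHm); last by lra.
have : 0 <= m%:R * y ^+ 2 by rewrite mulr_ge0// sqr_ge0.
by rewrite -natr1; lra.
Qed.

(** Writing b = G^(1-r), the left side is a weighted geometric mean of G and g, hence at most their
    maximum. *)
Lemma mulr_powR_le_max b g r : 0 <= b -> 0 <= g -> 0 <= r < 1 ->
  b * g `^ r <= Num.max g (b `^ (1 - r)^-1).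
Proof.
move=> b0 g0 /andP[r0 r1].
have r1_gt0 : 0 < 1 - r by lra.
set G := b `^ (1 - r)^-1.
have G0 : 0 <= G by exact: powR_ge0.
have bE : b = G `^ (1 - r) by rewrite -powRrM mulVf ?gt_eqF// powRr1.
set m := Num.max g G.
have gm : g <= m by rewrite le_max lexx.
have Gm : G <= m by rewrite le_max lexx orbT.
have m0 : 0 <= m by exact: le_trans gm.
apply: (@le_trans _ _ (m `^ (1 - r) * m `^ r)).
  rewrite bE; apply: ler_pM; rewrite ?powR_ge0//.
    by apply: ge0_ler_powR; rewrite ?nnegrE// ltW.
  by apply: ge0_ler_powR; rewrite ?nnegrE.
by rewrite -powRD ?subrK ?powRr1// oner_eq0.
Qed.

Lemma ln1DV_le u : 0 < u -> ln (1 + u^-1) <= u^-1.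
Proof.
move=> u0; apply: le_ln1Dx; apply: lt_trans (_ : 0 < u^-1);
  by rewrite ?invr_gt0// ltrN10.
Qed.

(** Both sides are compared with exp(-k/u). With u = t + l, the right side is (eta_(t+1)/eta_t)^k,
    so a term eta_t^k K survives a contraction step as eta_(t+1)^k K. *)
Lemma powR_ratio_ge u a k : 0 < u -> 0 <= k <= a ->
  1 - a / u <= (u / (u + 1)) `^ k.
Proof.
move=> u0 /andP[k0 ka]; rewrite /powR gt_eqF; last by rewrite divr_gt0//; lra.
have lnu : - u^-1 <= ln (u / (u + 1)).
  rewrite -[u / _]invrK lnV ?posrE ?invr_gt0 ?divr_gt0//; last by lra.
  rewrite lerN2 invf_div [_ / u](_ : _ = 1 + u^-1); first exact: ln1DV_le.
  by field; rewrite gt_eqF.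
apply: (@le_trans _ _ (expR (- (k / u)))).
  apply: le_trans (expR_ge1Dx _).
  by rewrite lerD2l lerN2 ler_pM2r ?invr_gt0.
by rewrite ler_expR -mulrN ler_wpM2l.
Qed.

Lemma powR_succ_ratio_le u k : 0 < u -> 0 <= k <= u ->
  ((u + 1) / u) `^ k <= expR 1.
Proof.
move=> u0 /andP[k0 ku]; rewrite /powR gt_eqF; last by rewrite divr_gt0//; lra.
rewrite ler_expR [(u + 1) / u](_ : _ = 1 + u^-1); last by field; rewrite gt_eqF.
have lnu := ln1DV_le u0.
apply: le_trans (ler_wpM2l k0 lnu) _.
by rewrite ler_pdivrMr// mul1r.
Qed.

(** ln(1 + 1/u) <= 1/u <= 2/(u+1), the last because u >= 1; this makes sums of 1/(u+1) telescope
    into logarithms. *)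
Lemma ln_succ_ratio_le u : 1 <= u -> ln ((u + 1) / u) / 2 <= (u + 1)^-1.
Proof.
move=> u1; have u0 : 0 < u by lra.
rewrite [(u + 1) / u](_ : _ = 1 + u^-1); last by field; rewrite gt_eqF.
have lnu := ln1DV_le u0.
rewrite ler_pdivrMr//; apply: le_trans lnu _.
by rewrite -div1r ler_pdivrMr// -mulrA mulrC ler_pdivlMr; lra.
Qed.

Lemma sum_inv_le_ln (N : nat) : (0 < N)%N ->
  \sum_(s < N) s.+1%:R^-1 <= 1 + ln N%:R :> R.
Proof.
elim: N => // -[|N] IH _; first by rewrite big_ord1 ln1 invr1 addr0.
rewrite big_ord_recr/=; apply: le_trans (lerD (IH isT) (lexx _)) _.
rewrite -addrA lerD2l -lerBrDl.
have N1 : 0 < N.+1%:R :> R by rewrite ltr0n.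
have N2 : 0 < N.+2%:R :> R by rewrite ltr0n.
rewrite -opprB lerNr -ln_div ?posrE//.
have -> : N.+1%:R / N.+2%:R = 1 + - N.+2%:R^-1 :> R.
  by rewrite -[N.+1%:R](addrK 1) natr1 mulrBl divff ?gt_eqF// mul1r.
apply: le_ln1Dx; rewrite ltrN2 invf_lt1// ltr1n//.
Qed.

(** The logarithm is -ln eta_N, the form needed later; ln l <= l - 1 pays for dividing by l. *)
Lemma sum_inv_le (l N : nat) : (0 < l)%N ->
  \sum_(s < N) s.+1%:R^-1 <= l%:R + ln ((N + l)%:R / l%:R) :> R.
Proof.
move=> l0; have lR : 0 < l%:R :> R by rewrite ltr0n.
case: N => [|N]; first by rewrite big_ord0 add0n divff ?gt_eqF// ln1 addr0 ltW.
apply: le_trans (sum_inv_le_ln (ltn0Sn N)) _.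
have lnN : ln N.+1%:R <= ln (N.+1 + l)%:R :> R.
  by rewrite ler_ln ?posrE ?ltr0n// ?addSn// ler_nat -addSn leq_addr.
have lnl : ln l%:R <= l%:R - 1 :> R.
  rewrite [X in ln X](_ : _ = 1 + (l%:R - 1)); last by lra.
  by apply: le_ln1Dx; lra.
by rewrite ln_div ?posrE// ?ltr0n ?addSn//; rewrite addSn in lnN; lra.
Qed.

End real_inequalities.

(** * The recursion for abstract real sequences: [pd] stands for the primal-dual gap, [g] for the
    Frank-Wolfe gap *)

Section frank_wolfe_recursion.
Context (R : realType) (l : nat) (l_gt0 : (0 < l)%N).
Context (M r eps : R) (M_gt0 : 0 < M) (r_itv : 0 <= r < 1).
Context (eps_itv : 0 < eps < l%:R).

Let a := l%:R - eps.
Let p := (1 - r)^-1.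
Let k := Num.min a p.
Let K := (l%:R * M / (2 * eps)) `^ p.
Let eta := stepsize R l.

Context (pd g : nat -> R).
Context (pd_ge0 : forall t, 0 <= pd t) (pd_le_g : forall t, pd t <= g t).
Context (pd_step : forall t,
  pd t.+1 <= pd t - eta t * g t + M * eta t ^+ 2 / 2 * g t `^ r).
Context (pd1_le : pd 1 <= M / 2).

Let lR : 0 < l%:R :> R. Proof. by rewrite ltr0n. Qed.
Let a_gt0 : 0 < a. Proof. by rewrite /a; case/andP: eps_itv; lra. Qed.
Let p_gt0 : 0 < p. Proof. by rewrite /p invr_gt0; case/andP: r_itv; lra. Qed.
Let k_gt0 : 0 < k. Proof. by rewrite lt_min a_gt0. Qed.
Let k_le_a : k <= a. Proof. by rewrite ge_min lexx. Qed.
Let k_le_p : k <= p. Proof. by rewrite ge_min lexx orbT. Qed.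
Let K_ge0 : 0 <= K. Proof. exact: powR_ge0. Qed.
Let tl_gt0 t : 0 < (t + l)%:R :> R.
Proof. by rewrite ltr0n addn_gt0 l_gt0 orbT. Qed.
Let eta_gt0 t : 0 < eta t. Proof. by rewrite divr_gt0. Qed.
Let eta_le1 t : eta t <= 1. Proof. by case/andP: (stepsize_itv R l t). Qed.

Lemma growth_term_le t : M * eta t ^+ 2 / 2 * g t `^ r <=
  eps / (t + l)%:R * Num.max (g t) (eta t `^ p * K).
Proof.
have /andP[e0 el] := eps_itv.
(* This factor b satisfies M eta_t^2 / 2 = (eps/(t+l)) b, and its power 1/(1-r) is the threshold
   eta_t^p K. *)
have b0 : 0 <= eta t * (l%:R * M / (2 * eps)).
  by rewrite mulr_ge0 ?(ltW (eta_gt0 t))// divr_ge0 ?mulr_ge0 ?ltW//.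
have /(mulr_powR_le_max b0) := le_trans (pd_ge0 t) (pd_le_g t).
move=> /(_ _ r_itv); rewrite powRM ?(ltW (eta_gt0 t))//; last first.
  by rewrite divr_ge0 ?mulr_ge0 ?ltW.
move=> le_max; apply: le_trans (ler_wpM2l _ le_max); last first.
  by rewrite divr_ge0 ?ltW.
rewrite le_eqVlt; apply/orP; left; apply/eqP.
by rewrite /eta /stepsize; field; rewrite -?natrD !gt_eqF//.
Qed.

Lemma pd_contraction t :
  pd t.+1 <= (1 - a / (t + l)%:R) * Num.max (pd t) (eta t `^ p * K).
Proof.
have /andP[e0 el] := eps_itv.
apply: le_trans (pd_step t) _.
have := growth_term_le t; have := pd_le_g t.
set G := _ * K; set Z := _ * g t `^ r.
have etaE : eta t = eps / (t + l)%:R + a / (t + l)%:R.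
  by rewrite -mulrDl /a addrC subrK.
have := eta_le1 t.
have : 0 <= eps / (t + l)%:R by rewrite divr_ge0 ?ltW.
have : 0 <= a / (t + l)%:R by rewrite divr_ge0 ?ltW.
rewrite etaE; set e := eps / _; set d := a / _ => d0 e1 ed1 hg.
have hm : pd t <= Num.max (pd t) G by rewrite le_max lexx.
have Gm : G <= Num.max (pd t) G by rewrite le_max lexx orbT.
have m1 : (1 - d) * pd t <= (1 - d) * Num.max (pd t) G.
  by rewrite ler_wpM2l//; lra.
have dg : d * pd t <= d * g t by rewrite ler_wpM2l.
(* Here eta_t = e + d. If g <= G, the growth term costs at most e G while (e + d) g >= (e + d) pd is
   gained; otherwise it costs at most e g and the gain d g >= d pd remains. *)
have [gG|Gg] := leP (g t) G.
- have eG : e * G <= e * Num.max (pd t) G by rewrite ler_wpM2l.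
  have edh : (1 - e - d) * pd t <= (1 - e - d) * Num.max (pd t) G.
    by rewrite ler_wpM2l//; lra.
  have eh : e * pd t <= e * g t by rewrite ler_wpM2l.
  by lra.
- by lra.
Qed.

(** Induction carrying two branches: the first propagates the initial bound M/2 and lags one index
    behind in eta, the second absorbs every threshold eta_t^p K met on the way. *)
Lemma pd_le_harmonic N :
  pd N.+1 <= Num.max
    (eta N ^+ l * expR (eps * \sum_(s < N) s.+1%:R^-1) * (M / 2))
    (eta N.+1 `^ k * K).
Proof.
have /andP[e0 el] := eps_itv.
elim: N => [|N IH].
  rewrite big_ord0 mulr0 expR0 mulr1 (_ : eta 0 = 1) ?expr1n ?mul1r.
    by rewrite le_max pd1_le.
  by rewrite /eta /stepsize divff ?gt_eqF.
apply: le_trans (pd_contraction N.+1) _.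
set u : R := (N.+1 + l)%:R.
have u0 : 0 < u by exact: tl_gt0.
have SN0 : 0 < N.+1%:R :> R by rewrite ltr0n.
have uE : u = N.+1%:R + l%:R by rewrite /u natrD.
have rho0 : 0 <= 1 - a / u.
  by rewrite subr_ge0 ler_pdivrMr// mul1r uE /a; lra.
have uS : (N.+2 + l)%:R = u + 1 by rewrite addSn natr1.
have -> : eta N.+2 = eta N.+1 * (u / (u + 1)).
  by rewrite /eta /stepsize uS -/u; field; rewrite !gt_eqF//; lra.
have eta_powk : eta N.+1 `^ p * K <= eta N.+1 `^ k * K.
  by rewrite ler_wpM2r// ger_powR// eta_gt0 eta_le1.
have w_gt0 : 0 < u / (u + 1) by rewrite divr_gt0//; lra.
have k_itv : 0 <= k <= a by rewrite ltW.
have rho_le : (1 - a / u) * (eta N.+1 `^ k * K) <=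
    (eta N.+1 * (u / (u + 1))) `^ k * K.
  rewrite powRM ?(ltW (eta_gt0 _)) ?(ltW w_gt0)// [leRHS]mulrAC [leRHS]mulrC.
  by rewrite ler_wpM2r ?mulr_ge0 ?powR_ge0// powR_ratio_ge.
rewrite maxr_pMr//.
rewrite ge_max; apply/andP; split; last first.
  apply: le_trans (ler_wpM2l rho0 eta_powk) _.
  by rewrite le_max rho_le orbT.
apply: le_trans (ler_wpM2l rho0 IH) _.
rewrite maxr_pMr// ge_max; apply/andP; split; last first.
  by rewrite le_max rho_le orbT.
rewrite le_max; apply/orP; left.
have M2_ge0 : 0 <= M / 2 by rewrite divr_ge0 ?ltW.
rewrite [leLHS]mulrA ler_wpM2r//.
rewrite big_ord_recr/= mulrDr expRD.
have u1 : 0 < u - 1 by rewrite uE -natr1; have := ler0n R N; lra.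
(* This ratio is what Bernoulli produces: 1 - l/u <= (1 - 1/u)^l. *)
have -> : eta N.+1 = eta N * (1 - u^-1).
  rewrite /eta /stepsize -/u (_ : (N + l)%:R = u - 1).
    by field; rewrite !gt_eqF//; move: u1; lra.
  by rewrite /u addSn -natr1 addrK.
rewrite (exprMn _ (eta N)) [leRHS](_ : _ =
  (1 - u^-1) ^+ l * expR (eps / N.+1%:R) *
  (eta N ^+ l * expR (eps * \sum_(s < N) s.+1%:R^-1))); last first.
  by rewrite mulrACA mulrC mulrACA; congr (_ * _); rewrite mulrC.
rewrite ler_wpM2r//.
  by rewrite mulr_ge0 ?expR_ge0// exprn_ge0// ltW.
apply: (@le_trans _ _ ((1 - l%:R / u) * (1 + eps / N.+1%:R))).
  rewrite le_eqVlt; apply/orP; left; apply/eqP.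
  rewrite uE /a; field; rewrite !gt_eqF//; lra.
apply: ler_pM.
- by rewrite subr_ge0 ler_pdivrMr// mul1r uE; lra.
- by rewrite addr_ge0// divr_ge0 ?ltW.
- apply: bernoulli_sub; rewrite invr_ge0 ltW//= invf_le1// uE -natr1.
  by have := ler0n R N; lra.
- exact: expR_ge1Dx.
Qed.

(** In the first branch, eta^a = eta^l exp(-eps ln eta), so the harmonic-sum bound costs just
    exp(eps l); in the second, that factor is at least 1. *)
Lemma pd_le t : (0 < t)%N ->
  pd t <= expR (eps * l%:R) *
    Num.max (eta t.-1 `^ a * (M / 2)) (eta t.-1 `^ k * K).
Proof.
have /andP[e0 el] := eps_itv.
case: t => // N _ /=; apply: le_trans (pd_le_harmonic N) _.
rewrite maxr_pMr ?expR_ge0//; apply: le_max2.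
  have M2_ge0 : 0 <= M / 2 by rewrite divr_ge0 ?ltW.
  rewrite [leRHS]mulrA ler_wpM2r//.
  have -> : eta N `^ a = eta N ^+ l * expR (eps * ln ((N + l)%:R / l%:R)).
    rewrite /a powRB ?gt_eqF ?eta_gt0 ?implybT//.
    rewrite powR_mulrn ?(ltW (eta_gt0 _))//.
    rewrite -powRN /powR gt_eqF// mulNr -mulrN -lnV ?posrE//.
    by rewrite /eta /stepsize invf_div.
  rewrite mulrCA ler_wpM2l ?exprn_ge0 ?(ltW (eta_gt0 _))//.
  by rewrite -expRD -mulrDr ler_expR ler_wpM2l ?sum_inv_le// ltW.
apply: (@le_trans _ _ (eta N `^ k * K)).
  rewrite ler_wpM2r//; apply: ge0_ler_powR;
    rewrite ?nnegrE ?(ltW k_gt0) ?(ltW (eta_gt0 _))//.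
  rewrite /eta /stepsize ler_wpM2l ?(ltW lR)// lef_pV2 ?posrE// ler_nat.
  by rewrite addSn leqnSn.
rewrite ler_peMl ?mulr_ge0 ?powR_ge0//.
by apply: le_trans (expR_ge1Dx _); rewrite lerDl mulr_ge0// ltW.
Qed.

(** Above the threshold the growth term consumes only the eps/(s+l) part of the step, leaving
    a/(s+l) times the gap as net decrease. *)
Lemma pd_descent (s : nat) (B : R) : eta s `^ p * K <= B -> B <= g s ->
  pd s.+1 <= pd s - a * B / (s + l)%:R.
Proof.
move=> GB Bg; apply: le_trans (pd_step s) _.
have := growth_term_le s; set Z := _ * g s `^ r.
rewrite (max_l (le_trans GB Bg)).
have -> : eta s = eps / (s + l)%:R + a / (s + l)%:R.
  by rewrite -mulrDl /a addrC subrK.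
have : a / (s + l)%:R * B <= a / (s + l)%:R * g s.
  by rewrite ler_wpM2l// divr_ge0 ?ltW.
by rewrite [a * B / _]mulrAC; lra.
Qed.

(** With q = s + l - 1, the denominators are q + 1, q + 2, and so on; trading each inverse for half
    a logarithm makes the losses telescope. *)
Lemma pd_descent_window (s q j : nat) (B : R) : (0 < q)%N -> (s + l = q.+1)%N ->
  0 <= B ->
  (forall i, (s <= i < s + j)%N -> eta i `^ p * K <= B <= g i) ->
  pd (s + j) <= pd s - a * B / 2 * ln ((q + j)%:R / q%:R).
Proof.
move=> q0 sq B0; elim: j => [|j IH] GBg.
  by rewrite !addn0 divff ?pnatr_eq0 -?lt0n// ln1 mulr0 subr0.
have qR : 0 < q%:R :> R by rewrite ltr0n.
have qj1 : 1 <= (q + j)%:R :> R by rewrite ler1n addn_gt0 q0.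
have qj0 : 0 < (q + j)%:R :> R by exact: lt_le_trans qj1.
have [|GB Bg] := andP (GBg (s + j)%N _); first by rewrite leq_addr addnS/=.
have := pd_descent GB Bg; rewrite -addnS => hS.
apply: le_trans hS _.
have -> : (s + j + l)%:R = (q + j)%:R + 1 :> R.
  by rewrite addnAC sq addSn natr1.
have hj : pd (s + j) <= pd s - a * B / 2 * ln ((q + j)%:R / q%:R).
  apply: IH => i /andP[si ij]; apply: GBg.
  by rewrite si (leq_trans ij)// leq_add2l.
have -> : (q + j.+1)%:R / q%:R =
    (q + j)%:R / q%:R * (((q + j)%:R + 1) / (q + j)%:R) :> R.
  by rewrite addnS natr1; field; rewrite -?natrD !gt_eqF.
rewrite lnM ?posrE ?divr_gt0 ?addr_gt0//.
have : a * B * (ln (((q + j)%:R + 1) / (q + j)%:R) / 2) <=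
    a * B * ((q + j)%:R + 1)^-1.
  by rewrite ler_wpM2l ?ln_succ_ratio_le// mulr_ge0// ltW.
by lra.
Qed.

Lemma exists_gap_le t : expR k^-1 * (1 + l%:R) <= (t + l)%:R ->
  exists2 i, (i <= t)%N &
    g i <= expR (3 + eps * l%:R) * eta t.-1 `^ k * Num.max (M / 2) K.
Proof.
move=> ct; have /andP[e0 el] := eps_itv.
set m := Num.max (M / 2) K.
set B := _ * m.
have m0 : 0 < m by rewrite lt_max divr_gt0.
have B0 : 0 < B by rewrite !mulr_gt0 ?expR_gt0// powR_gt0.
apply: contrapT => noi.
have Bg i : (i <= t)%N -> B < g i.
  by move=> it; rewrite ltNge; apply/negP => gB; apply: noi; exists i.
set N : R := (t + l)%:R in ct *.
set c := expR k^-1 in ct *.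
have c1 : 1 < c by rewrite expR_gt1 invr_gt0.
have c0 : 0 < c by lra.
have N0 : 0 < N by exact: tl_gt0.
have Nc0 : 0 <= N / c by rewrite divr_ge0 ?ltW.
have ck : c `^ k = expR 1 by rewrite -expRM mulVf// gt_eqF.
(* The window starts at index s + 1 with s + l = q. The assumption gives N/c >= l + 1, hence q > l
   and s is a natural number. *)
set q := Num.truncn (N / c).
have /andP[q_le q_gt] : q%:R <= N / c < q.+1%:R by exact: truncn_itv.
have lq : (l < q)%N by rewrite truncn_ge_nat// -nat1r ler_pdivlMr// mulrC.
have qt : (q < t + l)%N.
  rewrite -(ltr_nat R) (le_lt_trans q_le)// ltr_pdivrMr//.
  by rewrite -[ltLHS]mulr1 ltr_pM2l.
have q_gt0 : (0 < q)%N by exact: leq_ltn_trans lq.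
have qR : 0 < q%:R :> R by rewrite ltr0n.
have q1R : 0 < q.+1%:R :> R by rewrite ltr0n.
have [s sq] : exists s, (s.+1 + l = q.+1)%N.
  by exists (q - l)%N; rewrite addSn subnK// ltnW.
have lN_eta : l%:R / N <= eta t.-1.
  rewrite /eta /stepsize ler_wpM2l ?(ltW lR)// lef_pV2 ?posrE// ler_nat.
  by rewrite leq_add2r leq_pred.
(* Since q + 1 > N/c, going back to the start of the window costs a factor c in the step-size, which
   is e after raising to the power k. *)
have lq1 : (l%:R / q.+1%:R) `^ k <= expR 1 * eta t.-1 `^ k.
  rewrite -ck -powRM ?(ltW c0) ?(ltW (eta_gt0 _))//.
  apply: ge0_ler_powR; rewrite ?nnegrE ?(ltW k_gt0)//.
  - by rewrite mulr_ge0 ?(ltW c0) ?(ltW (eta_gt0 _)).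
  - apply: le_trans (ler_wpM2l (ltW c0) lN_eta).
    rewrite mulrCA ler_wpM2l ?(ltW lR)// -[c]invrK -invfM.
    rewrite lef_pV2 ?posrE ?ltr0n//.
      by rewrite mulrC ltW.
    by rewrite mulr_gt0 ?invr_gt0.
have GB i : (s < i)%N -> eta i `^ p * K <= B.
  move=> si; apply: (@le_trans _ _ (eta i `^ k * K)).
    by rewrite ler_wpM2r// ger_powR// eta_gt0 eta_le1.
  apply: ler_pM; rewrite ?powR_ge0//; last by rewrite le_max lexx orbT.
  apply: le_trans (_ : (l%:R / q.+1%:R) `^ k <= _).
    apply: ge0_ler_powR; rewrite ?nnegrE ?(ltW k_gt0) ?(ltW (eta_gt0 _))//.
    rewrite /eta /stepsize ler_wpM2l ?(ltW lR)// lef_pV2 ?posrE// ler_nat.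
    by rewrite -sq leq_add2r.
  apply: le_trans lq1 _; rewrite ler_wpM2r ?powR_ge0// ler_expR.
  have : 0 <= eps * l%:R by rewrite mulr_ge0 ?ltW.
  by lra.
have st : (s.+1 <= t.+1)%N.
  by rewrite -(leq_add2r l) sq addSn ltnW.
(* The window covers the indices s + 1 to t and ends at [pd t.+1]; its length added to q gives
   exactly t + l. *)
have := @pd_descent_window s.+1 q (t.+1 - s.+1)%N B q_gt0 sq (ltW B0).
rewrite subnKC// => /(_ _)/le_trans; move=> win.
have {win} hw : pd t.+1 <= pd s.+1 - a * B / 2 * ln (N / q%:R).
  rewrite /N; have <- : (q + (t.+1 - s.+1))%N = (t + l)%N.
    by move: sq st; clear; lia.
  apply: win; last by [].
  by move=> i /andP[si it]; rewrite GB//= ltW// Bg.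
have lnN : k^-1 <= ln (N / q%:R).
  rewrite -[k^-1]expRK ler_ln ?posrE ?expR_gt0 ?divr_gt0//.
  by rewrite ler_pdivlMr// mulrC -ler_pdivlMr.
have aB : B / 2 <= a * B / 2 * ln (N / q%:R).
  apply: le_trans (ler_wpM2l _ lnN); last first.
    by rewrite divr_ge0// mulr_ge0// ltW.
  have -> : a * B / 2 * k^-1 = B / 2 * (a / k) by ring.
  have ak : 1 <= a / k by rewrite ler_pdivlMr// mul1r.
  by rewrite ler_peMr// ltW// divr_gt0.
(* Of the e^3 in B, one e pays for the window, one for replacing q + 1 by q, and the third is the
   gain B/e, which beats B/2 because e > 2. *)
have hs : pd s.+1 <= B / expR 1.
  apply: le_trans (pd_le (ltn0Sn s)) _ => /=.
  have es : eta s = l%:R / q%:R.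
    by rewrite /eta /stepsize; congr (_ / _%:R); case: sq.
  have : eta s `^ k <= expR 2 * eta t.-1 `^ k.
    rewrite es [l%:R / _](_ : _ = l%:R / q.+1%:R * ((q%:R + 1) / q%:R)); last first.
      by rewrite natr1; field; rewrite -?natrD !gt_eqF// ltr0n.
    rewrite powRM ?divr_ge0 ?addr_ge0//.
    have /(ler_pM _ _ lq1) : ((q%:R + 1) / q%:R) `^ k <= expR 1.
      apply: powR_succ_ratio_le => //; rewrite (ltW k_gt0)/=.
      apply: le_trans k_le_a _; apply: le_trans (_ : l%:R <= _).
        by rewrite /a; lra.
      by rewrite ler_nat ltnW.
    move=> /(_ (powR_ge0 _ _) (powR_ge0 _ _))/le_trans; apply.
    by rewrite mulrAC -expRD.
  move=> es2.
  have -> : B / expR 1 = expR (eps * l%:R) * (expR 2 * eta t.-1 `^ k * m).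
    rewrite /B (_ : 3 + eps * l%:R = eps * l%:R + 2 + 1); last by lra.
    by rewrite 2!expRD; field; rewrite gt_eqF ?expR_gt0.
  rewrite ler_wpM2l ?expR_ge0// ge_max; apply/andP; split.
    apply: ler_pM; rewrite ?powR_ge0 ?(ltW (divr_gt0 M_gt0 _))//.
      by apply: le_trans es2; rewrite ger_powR// eta_gt0 eta_le1.
    by rewrite le_max lexx.
  by apply: ler_pM; rewrite ?powR_ge0// le_max lexx orbT.
have e2 : 2 < expR 1 :> R by have := @expR_gt1Dx R 1 (oner_neq0 _); lra.
have : B / expR 1 < B / 2 by rewrite ltr_pM2l// ltf_pV2 ?posrE ?expR_gt0.
by have := pd_ge0 t.+1; lra.
Qed.

End frank_wolfe_recursion.

(** * Asymptotic rates of the explicit bounds *)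

Section step_size_rates.
Context (R : realType).

(** The index 0 is left out because a negative power of 0 evaluates to 0, so the rate vanishes
    there. *)
Lemma nat_bigO_le (c : R) (F G : nat -> R) : 0 < c ->
  (forall t, (0 < t)%N -> 0 <= F t <= c * G t) -> F =O_\oo G.
Proof.
move=> c0 FG; apply/eqO_exP; exists c => //; exists 1%N => // t /= t0.
have /andP[F0 Fc] := FG t t0; rewrite ger0_norm// (le_trans Fc)//.
by rewrite ler_wpM2l ?ler_norm// ltW.
Qed.

Lemma stepsize_pred_powR_le (l t : nat) (a : R) : (0 < l)%N -> (0 < t)%N ->
  0 <= a -> stepsize R l t.-1 `^ a <= l%:R `^ a * t%:R `^ (- a).
Proof.
move=> l0 t0 a0; have tR : 0 < t%:R :> R by rewrite ltr0n.
have tl0 : 0 < (t.-1 + l)%:R :> R by rewrite ltr0n addn_gt0 l0 orbT.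
apply: (@le_trans _ _ ((l%:R * t%:R^-1) `^ a)).
  apply: ge0_ler_powR; rewrite ?nnegrE ?divr_ge0//.
  rewrite /stepsize ler_wpM2l// lef_pV2 ?posrE// ler_nat.
  by rewrite -[leqLHS](prednK t0) -addn1 leq_add2l.
by rewrite powRM ?invr_ge0// -[t%:R^-1]powR_inv1// -powRrM mulN1r.
Qed.

Lemma powR_Nmin_le (y a b : R) :
  y `^ (- Num.min a b) <= y `^ (- a) + y `^ (- b).
Proof.
by rewrite minEle; case: ifP => _; rewrite ?lerDl ?lerDr powR_ge0.
Qed.

End step_size_rates.

Theorem theorem3p4 (R : realType) (n : nat)
    (C U : set 'rV[R]_n) (f : 'rV[R]_n -> R)
    (C_compact : compact C) (C_convex : convex_set C)
    (f_convex : convex_function C f)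
    (U_open : open U) (C_sub_U : C `<=` U)
    (f_diff : forall y, U y -> differentiable f y)
    (l : nat) (l_ge1 : (1 <= l)%N)
    (M r : R) (M_gt0 : 0 < M) (r_itv : 0 <= r < 1)
    (growth0 : strong_growth C f M 0) (growthr : strong_growth C f M r)
    (eps : R) (eps_itv : 0 < eps < l%:R)
    (x v : nat -> 'rV[R]_n)
    (x_FW : frank_wolfe C f (stepsize R l) x v) :
  let eta := stepsize R l in
  let k := Num.min (l%:R - eps) (1 - r)^-1 in
  let c := expR (Num.min (l%:R - eps) (1 - r)^-1)^-1 in
  let K := (l%:R * M / (2 * eps)) `^ (1 - r)^-1 in
  let bound1 := fun t : nat =>
    expR (eps * l%:R) *
      Num.max (eta t.-1 `^ (l%:R - eps) * (M / 2)) (eta t.-1 `^ k * K) in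
  let bound2 := fun t : nat =>
    expR (3 + eps * l%:R) * eta t.-1 `^ k * Num.max (M / 2) K in
  let rate := fun t : nat =>
    t%:R `^ (- l%:R + eps) + t%:R `^ (- (1 - r)^-1) in
  ((forall t : nat, (1 <= t)%N -> primaldual C f x t <= bound1 t)
    /\ bound1 =O_\oo rate)
  /\
  ((forall t : nat, Num.ceil (c * (1 + l%:R) - l%:R) <= t%:Z ->
      running_min (fun i => gap C f (x i)) t <= bound2 t)
    /\ bound2 =O_\oo rate).
Proof.
move=> eta k c K bound1 bound2 rate.
have f_diffC y : C y -> differentiable f y by move=> /C_sub_U /f_diff.
have pd_ge0 := primaldual_ge0 x_FW C_convex f_convex f_diffC.
have pd_gap := primaldual_le_gap x_FW C_convex f_convex f_diffC.
have pd_step t := primaldual_descent x_FW C_convex f_convex f_diffC t growthr.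
have pd1 := primaldual1_le x_FW C_convex f_convex f_diffC l_ge1 growth0.
have /andP[eps0 epsl] := eps_itv.
have /andP[r0 r1] := r_itv.
have lR : 0 < l%:R :> R by rewrite ltr0n.
have a0 : 0 < l%:R - eps by rewrite subr_gt0.
have p0 : 0 < (1 - r)^-1 by rewrite invr_gt0 subr_gt0.
have k0 : 0 < k by rewrite lt_min a0.
have K0 : 0 <= K by exact: powR_ge0.
have M20 : 0 < M / 2 by rewrite divr_gt0.
have m0 : 0 < Num.max (M / 2) K by rewrite lt_max M20.
have rateE t : rate t = t%:R `^ (- (l%:R - eps)) + t%:R `^ (- (1 - r)^-1).
  by rewrite /rate opprB [- l%:R + eps]addrC.
have etak_le t : (0 < t)%N -> eta t.-1 `^ k <= l%:R `^ k * rate t.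
  move=> t0; apply: le_trans (stepsize_pred_powR_le l_ge1 t0 (ltW k0)) _.
  by rewrite ler_wpM2l ?powR_ge0// rateE powR_Nmin_le.
have etaa_le t : (0 < t)%N ->
    eta t.-1 `^ (l%:R - eps) <= l%:R `^ (l%:R - eps) * rate t.
  move=> t0; apply: le_trans (stepsize_pred_powR_le l_ge1 t0 (ltW a0)) _.
  by rewrite ler_wpM2l ?powR_ge0// rateE lerDl powR_ge0.
split; split.
- exact: (pd_le l_ge1 M_gt0 r_itv eps_itv pd_ge0 pd_gap pd_step pd1).
(* The constant adds the two branches of the maximum, each bounded separately by a multiple of the
   rate. *)
- apply: (@nat_bigO_le _ (expR (eps * l%:R) *
    (l%:R `^ (l%:R - eps) * (M / 2) + l%:R `^ k * K))).
    rewrite mulr_gt0 ?expR_gt0// ltr_pwDl ?mulr_gt0 ?powR_gt0//.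
    by rewrite mulr_ge0 ?powR_ge0.
  move=> t t0; rewrite mulr_ge0 ?expR_ge0//=; last first.
    by rewrite le_max mulr_ge0 ?powR_ge0// ltW.
  rewrite -mulrA ler_wpM2l ?expR_ge0// mulrDl.
  have A := ler_wpM2r (ltW M20) (etaa_le t t0).
  have B := ler_wpM2r K0 (etak_le t t0).
  have rate0 : 0 <= rate t by rewrite addr_ge0 ?powR_ge0.
  have A0 : 0 <= l%:R `^ (l%:R - eps) * (M / 2) * rate t.
    by rewrite !mulr_ge0 ?powR_ge0// ltW.
  have B0 : 0 <= l%:R `^ k * K * rate t by rewrite !mulr_ge0 ?powR_ge0.
  rewrite ge_max; apply/andP; split.
    by rewrite (le_trans A)// mulrAC lerDl.
  by rewrite (le_trans B)// mulrAC lerDr.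
(* The ceiling condition amounts to c (1 + l) <= t + l; as c > 1 it forces t >= 1, so [t.-1] is a
   true predecessor. *)
- move=> t; rewrite ceil_le_int lerBlDr -natrD => ct.
  have [i it gi] := exists_gap_le l_ge1 M_gt0 r_itv eps_itv
    pd_ge0 pd_gap pd_step pd1 ct.
  exact: le_trans (running_min_le (fun i => gap C f (x i)) it) gi.
- apply: (@nat_bigO_le _ (expR (3 + eps * l%:R) * l%:R `^ k * Num.max (M / 2) K)).
    by rewrite !mulr_gt0 ?expR_gt0 ?powR_gt0.
  move=> t t0; rewrite !mulr_ge0 ?expR_ge0 ?powR_ge0 ?(ltW m0)//=.
  rewrite [leRHS]mulrAC ler_wpM2r ?(ltW m0)// -mulrA ler_wpM2l ?expR_ge0//.
  exact: etak_le.
Qed.
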